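(* Let $p^N$ denote the price tested at the $N$-th iteration of the dichotomy (bisection) method, described in the context, applied to the compactified dual problem $\min_{p\in[0,p_{\max}]}\varphi(p)$ of the resource allocation problem $$\min\Big\{ f(\mathtt x)=\sum_{k=1}^n f_k(x_k)\ :\ \sum_{k=1}^n x_k\ge C,\ x_k\ge 0,\ k=1,\dots,n\Big\},$$ and let $\mathtt x^*=\mathtt x(p^* )$ be the solution of this problem. Then the convergence for the primal problem, both in function value and in argument, is geometric: for every integer $N\ge 1$, $$f(\mathtt x(p^N))-f(\mathtt x^* )\le \frac{1}{2^{N/2}}\Big(2L_\varphi M_\varphi (p_{\max})^3\Big)^{1/2},$$ $$\|\mathtt x(p^N)-\mathtt x(p^* )\|_2\le \frac{1}{2^{N/4}}\left(\Big(\frac{8L_\varphi M_\varphi (p_{\max})^3}{\mu^2}\Big)^{1/2}+\Big(\frac{8L_\varphi M_\varphi M_f^2\,p_{\max}}{n\mu^2}\Big)^{1/2}\right)^{1/2}+\frac{1}{2^{N/2}}\Big(\frac{2L_\varphi M_\varphi\, p_{\max}}{n}\Big)^{1/2}.$$ In particular, for $\varepsilon>0$, in order that $f(\mathtt x(p^N))-f(\mathtt x^* )\le\varepsilon$ it suffices to perform $$N=\log_2\left(\frac{2L_\varphi M_\varphi (p_{\max})^3}{\varepsilon^2}\right)$$ iterations of the dichotomy method (i.e. any integer $N\ge1$ that is at least this number).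
   Context: Setting. $n\ge1$ is an integer, $C>0$, $\mu>0$, and $f_k:[0,\infty)\to\mathbb R$, $k=1,\dots,n$, are increasing, $\mu$-strongly convex functions (cost functions); $f(\mathtt x)=\sum_{k=1}^n f_k(x_k)$ for $\mathtt x=(x_1,\dots,x_n)^\top$ with $x_k\ge0$. For a price $p\ge 0$ let $x_k(p)=\operatorname{arg\,max}_{x\ge0}\{px-f_k(x)\}$ (unique by strong convexity) and $\mathtt x(p)=(x_1(p),\dots,x_n(p))^\top$. The dual function is $$\varphi(p)=\sum_{k=1}^n\{p\,x_k(p)-f_k(x_k(p))\}-pC,$$ with derivative $\varphi'(p)=\sum_{k=1}^n x_k(p)-C$. Let $p^*$ be a solution of the dual problem $\min_{p\ge0}\varphi(p)$; it satisfies $\sum_{k=1}^n x_k(p^* )=C$, and $\mathtt x^*=\mathtt x(p^* )$ is the solution of the primal problem. Put $$p_{\max}=\frac1C\sum_{k=1}^n\Big\{f_k\Big(\frac{2C}{n}\Big)-f_k(0)\Big\},\qquad Q=[0,p_{\max}].$$ Constants: $L_\varphi=n/\mu$ (a Lipschitz constant of $\varphi'$); $M_\varphi$ is a Lipschitz constant of $\varphi$ on $Q$; $M_f$ is a Lipschitz constant, with respect to the Euclidean norm, of the primal objective $f$ on a region of the nonnegative orthant containing all points $\mathtt x(p)$, $p\in Q$, and their Euclidean projections onto the feasible set $\{\mathtt x\ge0:\sum_k x_k\ge C\}$. Dichotomy method: start with $[a,b]=[0,p_{\max}]$. At iteration $N=1,2,\dots$ set $p^N=(a+b)/2$ and compute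 $\varphi'(p^N)=\sum_k x_k(p^N)-C$. If $\varphi'(p^N)>0$, replace $b$ by $p^N$; if $\varphi'(p^N)<0$, replace $a$ by $p^N$; if $\varphi'(p^N)=0$, the solution is found and all later $p^{N'}$ are set equal to this $p^N$. *)

(* Defs.v *)
From HB Require Import structures.
From mathcomp Require Import all_boot all_order all_algebra.
From mathcomp Require Import all_classical all_reals all_analysis.

Set Implicit Arguments.
Unset Strict Implicit.
Unset Printing Implicit Defensive.

Import Order.TTheory GRing.Theory Num.Theory.
Import numFieldNormedType.Exports.

Local Open Scope classical_set_scope.
Local Open Scope ring_scope.

(* Cost functions are total functions [R -> R], but only their values on
   [0, +oo[ ever matter. *)

Definition strongly_convex_nneg (R : realType) (mu : R) (g : R -> R) : Prop :=
  forall x y t : R, 0 <= x -> 0 <= y -> 0 <= t -> t <= 1 ->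
    g (t * x + (1 - t) * y)
      <= t * g x + (1 - t) * g y - mu / 2 * t * (1 - t) * (x - y) ^+ 2.

(* [nondecreasing_nneg] and strong convexity together already give strict
   monotonicity on [0, +oo[, so the weak reading of "increasing" loses
   nothing. *)
Definition nondecreasing_nneg (R : realType) (g : R -> R) : Prop :=
  {in Num.nneg &, {homo g : x y / x <= y}}.

Definition enorm (R : realType) (n : nat) (x : 'cV[R]_n) : R :=
  Num.sqrt (\sum_k x k 0 ^+ 2).

Definition orthant (R : realType) (n : nat) : set 'cV[R]_n :=
  [set x | forall k, 0 <= x k 0].

Definition feasible (R : realType) (n : nat) (C : R) : set 'cV[R]_n :=
  [set x | orthant x /\ C <= \sum_k x k 0].

Definition cost (R : realType) (n : nat) (f : 'I_n -> R -> R)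
    (x : 'cV[R]_n) : R :=
  \sum_k f k (x k 0).

Definition primal_solution (R : realType) (n : nat) (f : 'I_n -> R -> R)
    (C : R) : set 'cV[R]_n :=
  [set x | feasible C x /\ forall y, feasible C y -> cost f x <= cost f y].

Definition euclidean_projection (R : realType) (n : nat) (A : set 'cV[R]_n)
    (x : 'cV[R]_n) : set 'cV[R]_n :=
  [set y | A y /\ forall z, A z -> enorm (x - y) <= enorm (x - z)].

(* argmax over x >= 0 of p x - g x, as a set *)
Definition argmax_profit (R : realType) (g : R -> R) (p : R) : set R :=
  [set x | 0 <= x /\ forall y, 0 <= y -> p * y - g y <= p * x - g x].

(* [xget] picks an element of the argmax; its default value 0 is only returned
   if the argmax is empty, which does not happen for the cost functions
   considered. *)
Definition response (R : realType) (n : nat) (f : 'I_n -> R -> R) (p : R) :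
    'cV[R]_n :=
  \col_k xget 0 (argmax_profit (f k) p).

Definition dual (R : realType) (n : nat) (f : 'I_n -> R -> R) (C p : R) : R :=
  \sum_k (p * response f p k 0 - f k (response f p k 0)) - p * C.

(* The derivative of [dual], in the closed form in which it is evaluated by
   the dichotomy method. *)
Definition dual_deriv (R : realType) (n : nat) (f : 'I_n -> R -> R)
    (C p : R) : R :=
  \sum_k response f p k 0 - C.

Definition dual_solution (R : realType) (n : nat) (f : 'I_n -> R -> R)
    (C : R) : set R :=
  [set p | 0 <= p /\ forall q, 0 <= q -> dual f C p <= dual f C q].

Definition pmax (R : realType) (n : nat) (f : 'I_n -> R -> R) (C : R) : R :=
  C^-1 * \sum_k (f k (2 * C / n%:R) - f k 0).

Definition midpoint (R : realType) (ab : R * R) : R := (ab.1 + ab.2) / 2.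

(* If [dphi] vanishes at the midpoint the interval is left unchanged: the same
   midpoint is then tested at every later iteration. *)
Definition dichotomy_step (R : realType) (dphi : R -> R) (ab : R * R) : R * R :=
  let p := midpoint ab in
  if 0 < dphi p then (ab.1, p) else
  if dphi p < 0 then (p, ab.2) else ab.

(* The price tested at iteration N, for N >= 1: it is the midpoint of the
   interval reached after N - 1 updates. *)
Definition dichotomy_price (R : realType) (n : nat) (f : 'I_n -> R -> R)
    (C : R) (N : nat) : R :=
  midpoint (iter N.-1 (dichotomy_step (dual_deriv f C)) (0, pmax f C)).

Definition log2 (R : realType) (x : R) : R := ln x / ln 2.

(* Main.v *)
Require Import Defs.
From HB Require Import structures.
From mathcomp Require Import all_boot all_order all_algebra.
From mathcomp Require Import all_classical all_reals all_analysis.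
From mathcomp Require Import ring lra.

Set Implicit Arguments.
Unset Strict Implicit.
Unset Printing Implicit Defensive.

Import Order.TTheory GRing.Theory Num.Theory.
Import numFieldNormedType.Exports.

Local Open Scope classical_set_scope.
Local Open Scope ring_scope.

(** The theorem rests on one inequality. Write x(p) for [response f p] and d(p)
for [dual_deriv f C p]. A profit p x - f_k(x) is maximal at x_k(p) and
mu-strongly concave, so any other quantity y_k loses at least
mu/2 (x_k(p) - y_k)^2; summing over k gives weak Lagrangian duality with a
quadratic remainder ([lagrangian_gap]):
  p (sum_k y_k - C) - cost y + mu/2 |x(p) - y|^2 <= dual p.
Everything else is an instance of it.
- Taking y = x(q) shows that d is a subgradient of the dual function, which
  grows by at least mu/2 |x(p) - x(q)|^2 beyond its tangent ([dual_growth]).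
  Adding the inequality with p and q exchanged, d is nondecreasing and
  n/mu-Lipschitz, so that d vanishes at every dual solution, because d(0) = - C
  is negative ([dual_solution_deriv]).
- Taking y feasible and p a dual solution shows that x(p) is the only primal
  solution ([primal_solution_response]).
- Taking y_k = 2C/n and p = pmax shows d(pmax) > 0, so all dual solutions lie
  below pmax ([dual_deriv_pmax_gt0]).

Bisection on the sign of the monotone function d keeps pstar in an interval of
length pmax / 2^(N-1), or stops at another zero of d, which is a dual minimum
too. In both cases dual(pN) - dual(pstar) <= Mphi pmax / 2^N
([dual_gap_dichotomy_price]). Since d(pstar) = 0, [dual_growth] turns this into
  mu/2 |x(pN) - x(pstar)|^2 <= Mphi pmax / 2^N,
which is exactly the second summand of the bound on the argument; the first
summand is nonnegative. For the value, cost (x(p)) = p d(p) - dual p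
and the minimality of pstar give
  cost (x(pN)) - cost (x(pstar)) <= pN d(pN) <= pmax |d(pN)|,
and |d(pN)|^2 <= n |x(pN) - x(pstar)|^2 by Cauchy-Schwarz. *)

(** * Profit maximisation for one strongly convex cost *)

Lemma lipschitz_within_continuous (R : realType) (g : R -> R) (a b K : R) :
  (forall x y, a <= x -> x <= y -> y <= b -> `|g y - g x| <= K * (y - x)) ->
  {within `[a, b], continuous g}.
Proof.
move=> gK; have gK' x y : a <= x <= b -> a <= y <= b ->
    `|g x - g y| <= (`|K| + 1) * `|x - y|.
  move=> /andP[ax xb] /andP[ay yb]; wlog xy : x y ax xb ay yb / x <= y.
    move=> H; case: (leP x y) => [|/ltW] xy; first exact: H.
    by rewrite distrC (distrC x); apply: H.
  rewrite distrC (distrC x) (ger0_norm (_ : 0 <= y - x)) ?subr_ge0//.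
  apply: le_trans (gK _ _ ax xy yb) _; apply: ler_wpM2r; first by rewrite subr_ge0.
  by rewrite (le_trans (ler_norm K))// lerDl.
apply/subspace_continuousP => x xab'; apply/cvgrPdist_le => e e0.
rewrite near_withinE; near=> y => yab.
move: xab' yab; rewrite /= !in_itv /= => xab' yab.
apply: le_trans (gK' _ _ xab' yab) _.
rewrite mulrC -ler_pdivlMr; last by rewrite ltr_wpDl.
near: y; apply: cvgr_dist_le; first exact: cvg_id.
by rewrite divr_gt0// ltr_wpDl.
Unshelve. all: by end_near. Qed.

(** By convexity the slope between x and y is at most the slope between x and
B + 1, whose run is at least 1. Monotonicity is what excludes a jump at the
endpoint 0, which a convex function on a half-line may have. *)
Lemma nondecreasing_convex_lipschitz (R : realType) (mu : R) (g : R -> R) (B : R) :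
  0 <= mu -> nondecreasing_nneg g -> strongly_convex_nneg mu g ->
  forall x y, 0 <= x -> x <= y -> y <= B ->
    `|g y - g x| <= (g (B + 1) - g 0) * (y - x).
Proof.
move=> mu0 gi gc x y x0 xy yB.
have homo u v : 0 <= u -> u <= v -> g u <= g v.
  by move=> u0 uv; apply: gi; rewrite ?inE ?nnegrE ?(le_trans u0 uv).
rewrite ger0_norm ?subr_ge0; last exact: homo.
have d1 : 1 <= B + 1 - x by lra.
have d0 : 0 < B + 1 - x by lra.
set t := (B + 1 - y) / (B + 1 - x).
have t0 : 0 <= t by apply: divr_ge0; lra.
have t1 : t <= 1 by rewrite ler_pdivrMr//; lra.
have := gc x (B + 1) t x0 ltac:(lra) t0 t1.
have -> : t * x + (1 - t) * (B + 1) = y by rewrite /t; field; rewrite gt_eqF.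
have : 0 <= mu / 2 * t * (1 - t) * (x - (B + 1)) ^+ 2.
  by rewrite mulr_ge0 ?sqr_ge0// mulr_ge0 ?subr_ge0// mulr_ge0// divr_ge0.
have tE : 1 - t = (y - x) / (B + 1 - x) by rewrite /t; field; rewrite gt_eqF.
have t2 : 1 - t <= y - x by rewrite tE ler_pdivrMr// ler_peMr// subr_ge0.
have gx := homo 0 x (lexx _) x0.
have gB := homo x (B + 1) x0 ltac:(lra).
nra.
Qed.

(** Strong convexity between 0 and x, evaluated at the point 1, together with
g 0 <= g 1. *)
Lemma strongly_convex_quadratic_growth (R : realType) (mu : R) (g : R -> R) (x : R) :
  nondecreasing_nneg g -> strongly_convex_nneg mu g -> 1 <= x ->
  g 0 + mu / 2 * x * (x - 1) <= g x.
Proof.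
move=> gi gc x1; have x0 : 0 < x by lra.
have xV0 : 0 <= x^-1 by rewrite invr_ge0; lra.
have := gc x 0 x^-1 (ltW x0) (lexx _) xV0 ltac:(by rewrite invf_le1).
have -> : x^-1 * x + (1 - x^-1) * 0 = 1 by field; rewrite gt_eqF.
have : g 0 <= g 1 by apply: gi; rewrite ?inE ?nnegrE ?ler01.
move=> g01 /(le_trans g01); rewrite -(ler_pM2l x0) => H.
have E : x * (x^-1 * g x + (1 - x^-1) * g 0
    - mu / 2 * x^-1 * (1 - x^-1) * (x - 0) ^+ 2)
  = g x + (x - 1) * g 0 - mu / 2 * x * (x - 1) by field; rewrite gt_eqF.
by move: H; rewrite E; lra.
Qed.

(** Quadratic growth of the cost reduces the search to a compact interval, on
which the profit is continuous. *)
Lemma argmax_profit_nonempty (R : realType) (mu : R) (g : R -> R) (p : R) :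
  0 < mu -> nondecreasing_nneg g -> strongly_convex_nneg mu g -> 0 <= p ->
  exists x, argmax_profit g p x.
Proof.
move=> mu0 gi gc p0; set B := 1 + 2 * p / mu.
have pmu : 0 <= 2 * p / mu by apply: divr_ge0; [lra|exact: ltW].
have B1 : 1 <= B by rewrite /B; lra.
have B0 : 0 <= B by lra.
have cont : {within `[0, B], continuous (fun x => p * x - g x)}.
  apply: (@lipschitz_within_continuous _ _ _ _ (p + (g (B + 1) - g 0))) => x y x0 xy yB.
  have := nondecreasing_convex_lipschitz (ltW mu0) gi gc x0 xy yB.
  rewrite !ler_norml => /andP[h1 h2]; apply/andP; split; nra.
have [x + xmax] := EVT_max B0 cont.
rewrite in_itv /= => /andP[x0 xB]; exists x; split => // y y0.
case: (leP y B) => yB; first by apply: xmax; rewrite in_itv /= y0.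
(* past B the cost has overtaken the revenue, so even x = 0 does better *)
apply: le_trans (xmax 0 _); last by rewrite in_itv /= lexx.
have := strongly_convex_quadratic_growth gi gc (ltW (le_lt_trans B1 yB)).
have : p <= mu / 2 * (y - 1).
  have : 2 * p / mu <= y - 1 by move: yB; rewrite /B; lra.
  by rewrite ler_pdivrMr//; lra.
nra.
Qed.

(** Comparing the maximiser x with t y + (1 - t) x, dividing by t and letting t
tend to 0. *)
Lemma argmax_profit_gap (R : realType) (mu : R) (g : R -> R) (p x y : R) :
  0 < mu -> strongly_convex_nneg mu g -> argmax_profit g p x -> 0 <= y ->
  p * y - g y + mu / 2 * (x - y) ^+ 2 <= p * x - g x.
Proof.
move=> mu0 gc [x0 xmax] y0.
set a := p * y - g y - (p * x - g x); set b := mu / 2 * (x - y) ^+ 2.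
have a0 : a <= 0 by rewrite /a subr_le0 xmax.
have b0 : 0 <= b by rewrite mulr_ge0 ?sqr_ge0// divr_ge0// ltW.
suff : a + b <= 0 by rewrite /a; lra.
rewrite leNgt; apply/negP => ab.
have bgt0 : 0 < b by lra.
(* a value of t small enough to leave a + (1 - t) b = (a + b) / 2 positive *)
set t := (a + b) / (2 * b).
have t0 : 0 < t by apply: divr_gt0; lra.
have t1 : t < 1 by rewrite ltr_pdivrMr; lra.
have key : a + (1 - t) * b <= 0.
  have z0 : 0 <= t * y + (1 - t) * x by nra.
  have h1 := gc y x t y0 x0 (ltW t0) (ltW t1).
  have h2 := xmax _ z0.
  rewrite -(pmulr_rle0 _ t0) /a /b; lra.
have tb : t * b = (a + b) / 2 by rewrite /t; field; rewrite gt_eqF.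
lra.
Qed.

(** * Euclidean norm *)

(** Cauchy-Schwarz against the all-ones vector, from the nonnegativity of the
variance. *)
Lemma sqr_sum_le (R : realType) (n : nat) (z : 'I_n -> R) :
  (\sum_k z k) ^+ 2 <= n%:R * \sum_k z k ^+ 2.
Proof.
case: n z => [|n] z; first by rewrite !big_ord0 expr0n mulr0.
set S := \sum_k z k; set m := S / n.+1%:R.
have n0 : n.+1%:R != 0 :> R by rewrite pnatr_eq0.
have : 0 <= \sum_k (z k - m) ^+ 2 by rewrite sumr_ge0// => k _; exact: sqr_ge0.
have -> : \sum_k (z k - m) ^+ 2 = \sum_k z k ^+ 2 - 2 * m * S + n.+1%:R * m ^+ 2.
  rewrite (eq_bigr (fun k => z k ^+ 2 - 2 * m * z k + m ^+ 2)); last by move=> k _; ring.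
  by rewrite !big_split/= sumr_const card_ord sumrN -mulr_sumr (mulr_natl (m ^+ 2)).
rewrite -(pmulr_rge0 _ (_ : 0 < n.+1%:R)) ?ltr0n//.
rewrite (_ : _ * (_ + _) = n.+1%:R * \sum_k z k ^+ 2 - S ^+ 2) ?subr_ge0//.
by rewrite /m; field.
Qed.

Lemma colB (R : realType) (n : nat) (y z : 'cV[R]_n) k :
  (y - z) k 0 = y k 0 - z k 0.
Proof. by rewrite !mxE. Qed.

Lemma enorm_ge0 (R : realType) (n : nat) (z : 'cV[R]_n) : 0 <= enorm z.
Proof. exact: sqrtr_ge0. Qed.

Lemma sqr_enorm (R : realType) (n : nat) (z : 'cV[R]_n) :
  enorm z ^+ 2 = \sum_k z k 0 ^+ 2.
Proof. by rewrite sqr_sqrtr//; apply: sumr_ge0 => k _; exact: sqr_ge0. Qed.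

Lemma enorm_eq0 (R : realType) (n : nat) (z : 'cV[R]_n) : enorm z ^+ 2 <= 0 -> z = 0.
Proof.
rewrite sqr_enorm => z0.
have /psumr_eq0P zk : \sum_k z k 0 ^+ 2 = 0.
  by apply: le_anti; rewrite z0 sumr_ge0// => k _; exact: sqr_ge0.
apply/colP => k; rewrite mxE; apply/eqP; rewrite -sqrf_eq0; apply/eqP.
by apply: zk => // i _; exact: sqr_ge0.
Qed.

Lemma enormB (R : realType) (n : nat) (y z : 'cV[R]_n) : enorm (y - z) = enorm (z - y).
Proof.
by rewrite /enorm; congr Num.sqrt; apply: eq_bigr => k _; rewrite !mxE -sqrrN opprB.
Qed.

(** * The dual function and its derivative *)

Section DualProblem.
Context (R : realType) (n : nat) (C mu : R) (f : 'I_n -> R -> R).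
Hypothesis mu_gt0 : 0 < mu.
Hypothesis f_incr : forall k, nondecreasing_nneg (f k).
Hypothesis f_cvx : forall k, strongly_convex_nneg mu (f k).

Lemma response_argmax (p : R) (k : 'I_n) : 0 <= p ->
  argmax_profit (f k) p (response f p k 0).
Proof.
move=> p0; rewrite mxE; apply: xgetPex.
exact: argmax_profit_nonempty mu_gt0 (f_incr k) (f_cvx k) p0.
Qed.

Lemma response_orthant (p : R) : 0 <= p -> orthant (response f p).
Proof. by move=> p0 k; have [] := response_argmax k p0. Qed.

Lemma dualE (p : R) :
  dual f C p = p * dual_deriv f C p - cost f (response f p).
Proof. by rewrite /dual /dual_deriv sumrB -mulr_sumr mulrBr addrAC. Qed.

(** Weak duality with a quadratic remainder, the source of all later
estimates. *)
Lemma lagrangian_gap (p : R) (y : 'cV[R]_n) : 0 <= p -> orthant y ->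
  p * (\sum_k y k 0 - C) - cost f y + mu / 2 * enorm (response f p - y) ^+ 2
    <= dual f C p.
Proof.
move=> p0 y0; rewrite /dual.
rewrite [leLHS](_ : _ = \sum_k (p * y k 0 - f k (y k 0)
    + mu / 2 * (response f p - y) k 0 ^+ 2) - p * C); last first.
  by rewrite !big_split/= sumrN -!mulr_sumr sqr_enorm /cost; ring.
rewrite lerD2r; apply: ler_sum => k _; rewrite colB.
exact: argmax_profit_gap mu_gt0 (f_cvx k) (response_argmax k p0) (y0 k).
Qed.

(** [lagrangian_gap] at y = response f q. *)
Lemma dual_growth (p q : R) : 0 <= p -> 0 <= q ->
  dual f C q + dual_deriv f C q * (p - q)
    + mu / 2 * enorm (response f p - response f q) ^+ 2 <= dual f C p.
Proof.
move=> p0 q0; apply: le_trans (lagrangian_gap p0 (response_orthant q0)).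
by rewrite dualE -/(dual_deriv f C q); lra.
Qed.

Lemma dual_deriv_sqr (p q : R) :
  (dual_deriv f C p - dual_deriv f C q) ^+ 2
    <= n%:R * enorm (response f p - response f q) ^+ 2.
Proof.
rewrite sqr_enorm; apply: le_trans (sqr_sum_le _).
rewrite /dual_deriv (_ : _ - _ - _ =
  \sum_k response f p k 0 - \sum_k response f q k 0); last by ring.
by rewrite -sumrB; under [in leRHS]eq_bigr do rewrite colB.
Qed.

(** [dual_growth] added to itself with p and q exchanged. *)
Lemma response_monotone (p q : R) : 0 <= p -> 0 <= q ->
  mu * enorm (response f p - response f q) ^+ 2
    <= (p - q) * (dual_deriv f C p - dual_deriv f C q).
Proof.
move=> p0 q0; have := dual_growth p0 q0; have := dual_growth q0 p0.
by rewrite (enormB (response f q)); lra.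
Qed.

Lemma dual_deriv_homo (p q : R) : 0 <= p -> p <= q ->
  dual_deriv f C p <= dual_deriv f C q.
Proof.
move=> p0 pq; have q0 := le_trans p0 pq.
have [->//|qp] := eqVneq p q.
have := response_monotone q0 p0.
have : 0 <= mu * enorm (response f q - response f p) ^+ 2.
  by rewrite mulr_ge0 ?sqr_ge0// ltW.
move=> /le_trans /[apply]; rewrite pmulr_rge0 ?subr_ge0//.
by rewrite subr_gt0 lt_neqAle qp.
Qed.

Lemma dual_deriv_lipschitz (p q : R) : 0 <= p -> p <= q ->
  dual_deriv f C q - dual_deriv f C p <= n%:R / mu * (q - p).
Proof.
move=> p0 pq; have q0 := le_trans p0 pq.
have := response_monotone q0 p0; have := dual_deriv_sqr q p.
set d := _ - _; set e := enorm _ ^+ 2 => h1 h2.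
have d0 : 0 <= d by rewrite subr_ge0 dual_deriv_homo.
have n0 : 0 <= n%:R :> R by [].
have h : mu * d ^+ 2 <= n%:R * ((q - p) * d).
  have := ler_wpM2l n0 h2; have := ler_wpM2l (ltW mu_gt0) h1; lra.
have [->|dn0] := eqVneq d 0.
  by rewrite mulr_ge0 ?subr_ge0// divr_ge0// ltW.
have dgt0 : 0 < d by rewrite lt_neqAle eq_sym dn0.
rewrite mulrAC ler_pdivlMr// -(ler_pM2r dgt0); lra.
Qed.

Lemma response0 : response f 0 = 0.
Proof.
apply/colP => k; rewrite [RHS]mxE.
have xk := response_argmax k (lexx 0).
have := argmax_profit_gap mu_gt0 (f_cvx k) xk (lexx 0).
have [x0 _] := xk; have : f k 0 <= f k (response f 0 k 0).
  by apply: f_incr; rewrite ?inE ?nnegrE.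
move: (response f 0 k 0) => x fx; rewrite !mul0r !subr0 => h.
apply/eqP; rewrite -sqrf_eq0 eq_le sqr_ge0 andbT.
have mu2 : 0 < mu / 2 by rewrite divr_gt0.
by rewrite -(pmulr_rle0 _ mu2); lra.
Qed.

Lemma dual_deriv0 : dual_deriv f C 0 = - C.
Proof.
by rewrite /dual_deriv response0 big1 ?add0r// => k _; rewrite mxE.
Qed.

(** If the derivative were nonzero at the minimiser p, it would keep its sign
nearby by Lipschitz continuity, and a small move against that sign would lower
the dual. The only move that could leave the half-line is to the left from
p = 0, but there the derivative is - C < 0. *)
Lemma dual_solution_deriv (p : R) : 0 < C -> dual_solution f C p ->
  dual_deriv f C p = 0.
Proof.
move=> C0 [p0 pmin].
have mun : 0 <= n%:R / mu by rewrite divr_ge0// ltW.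
have growth q : 0 <= q -> 0 <= dual_deriv f C q * (q - p).
  move=> q0; have := dual_growth p0 q0; have := pmin _ q0.
  have : 0 <= mu / 2 * enorm (response f p - response f q) ^+ 2.
    by rewrite mulr_ge0 ?sqr_ge0// divr_ge0// ltW.
  lra.
(* a move of length |d| / K, being shorter than |d| / (2 n / mu), changes the
   derivative by less than |d| / 2 *)
set K := 2 * (n%:R / mu) + 1.
have K0 : 0 < K by rewrite /K; lra.
set d := dual_deriv f C p.
have [d0|d0|//] := ltgtP d 0.
- (* the derivative is still negative a little to the right of p *)
  set e := - d / K; have e0 : 0 < e by rewrite divr_gt0// oppr_gt0.
  have pe : 0 <= p + e by lra.
  have := growth _ pe; rewrite [p + e - p](_ : _ = e); last by ring.
  rewrite pmulr_lge0//.
  have := @dual_deriv_lipschitz p (p + e) p0 ltac:(lra).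
  rewrite -/d [p + e - p](_ : _ = e); last by ring.
  have : 2 * (n%:R / mu * e) + e = - d.
    rewrite /e; set u := n%:R / mu; rewrite -[RHS](mulfVK (lt0r_neq0 K0)) /K -/u; ring.
  lra.
- (* the derivative is still positive a little to the left of p *)
  have pgt0 : 0 < p.
    rewrite lt_neqAle p0 andbT; apply/eqP => p00.
    by move: d0; rewrite /d -p00 dual_deriv0 oppr_gt0 ltNge (ltW C0).
  set e := Num.min p (d / K).
  have e0 : 0 < e by rewrite lt_min pgt0 divr_gt0.
  have ep : e <= p by rewrite ge_min lexx.
  have pe : 0 <= p - e by lra.
  have := growth _ pe; rewrite [p - e - p](_ : _ = - e); last by ring.
  rewrite mulrN oppr_ge0 pmulr_lle0//.
  have := @dual_deriv_lipschitz (p - e) p pe ltac:(lra).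
  rewrite -/d [p - (p - e)](_ : _ = e); last by ring.
  have eK : e <= d / K by rewrite ge_min lexx orbT.
  have : 2 * (n%:R / mu * e) + e <= d.
    by move: eK; rewrite ler_pdivlMr// /K; lra.
  lra.
Qed.

Lemma pmax_ge0 : 0 < C -> 0 <= pmax f C.
Proof.
move=> C0; rewrite mulr_ge0 ?invr_ge0 ?(ltW C0)//; apply: sumr_ge0 => k _.
have y0 : 0 <= 2 * C / n%:R by rewrite divr_ge0// mulr_ge0// ltW.
by rewrite subr_ge0; apply: f_incr; rewrite ?inE ?nnegrE.
Qed.

(** The value of pmax is chosen so that C pmax is the extra cost of producing
2C/n everywhere instead of nothing. Were demand at pmax at most C, the plan 2C/n
of total 2C would be at least as profitable, hence equal to the response by
strict optimality, and its total would exceed C. *)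
Lemma dual_deriv_pmax_gt0 : (0 < n)%N -> 0 < C ->
  0 < dual_deriv f C (pmax f C).
Proof.
move=> n0 C0; have P0 := pmax_ge0 C0.
have nR0 : n%:R != 0 :> R by rewrite pnatr_eq0 -lt0n.
set p := pmax f C; pose y : 'cV[R]_n := const_mx (2 * C / n%:R).
have yk k : y k 0 = 2 * C / n%:R by rewrite mxE.
have y0 : orthant y by move=> k; rewrite yk divr_ge0// mulr_ge0// ltW.
have sy : \sum_k y k 0 = 2 * C.
  under eq_bigr do rewrite yk.
  by rewrite sumr_const card_ord -(mulr_natr (2 * C / _)) divfK.
have pC : p * C = cost f y - cost f 0.
  rewrite /p /pmax mulrAC mulVf ?gt_eqF// mul1r sumrB /cost.
  by congr (_ - _); apply: eq_bigr => k _; rewrite mxE.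
have cost0 : cost f 0 <= cost f (response f p).
  apply: ler_sum => k _; have xk := response_orthant P0 k.
  have -> : (0 : 'cV[R]_n) k 0 = 0 by rewrite mxE.
  by apply: f_incr; rewrite ?inE ?nnegrE.
have := lagrangian_gap P0 y0; rewrite dualE sy -/p => gap.
rewrite ltNge; apply/negP => d0.
have pd : p * dual_deriv f C p <= 0 by rewrite mulr_ge0_le0.
have mu2 : 0 < mu / 2 by rewrite divr_gt0.
have /enorm_eq0/subr0_eq xy : enorm (response f p - y) ^+ 2 <= 0.
  by rewrite -(pmulr_rle0 _ mu2); lra.
by move: d0; rewrite /dual_deriv xy sy; lra.
Qed.

Lemma dual_solution_lt_pmax (p : R) : (0 < n)%N -> 0 < C ->
  dual_solution f C p -> p < pmax f C.
Proof.
move=> n0 C0 psol; rewrite ltNge; apply/negP => Pp.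
have := dual_deriv_homo (pmax_ge0 C0) Pp.
by rewrite (dual_solution_deriv C0 psol) leNgt dual_deriv_pmax_gt0.
Qed.

(** * Primal solution *)

(** Since the dual derivative vanishes at p, the dual value is minus the cost of
the response; [lagrangian_gap] then bounds the cost of any feasible y from
below, with a quadratic term that forces uniqueness. *)
Lemma primal_solution_response (p : R) : 0 < C -> dual_solution f C p ->
  primal_solution f C = [set response f p].
Proof.
move=> C0 psol; have p0 := psol.1.
have d0 := dual_solution_deriv C0 psol.
have dualp : dual f C p = - cost f (response f p) by rewrite dualE d0 mulr0 sub0r.
have gap y : feasible C y ->
    cost f (response f p) + mu / 2 * enorm (response f p - y) ^+ 2 <= cost f y.
  move=> [y0 yC]; have := lagrangian_gap p0 y0; rewrite dualp.
  have : 0 <= p * (\sum_k y k 0 - C) by rewrite mulr_ge0// subr_ge0.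
  lra.
have mu2 : 0 < mu / 2 by rewrite divr_gt0.
have xfeas : feasible C (response f p).
  by split; [exact: response_orthant|rewrite -subr_ge0 -/(dual_deriv f C p) d0].
apply/seteqP; split => [y [yfeas ymin]|_ ->].
  have := gap _ yfeas; have := ymin _ xfeas => h1 h2.
  apply/esym/subr0_eq/enorm_eq0; rewrite -(pmulr_rle0 _ mu2); lra.
split => // y /gap; apply: le_trans.
by rewrite lerDl mulr_ge0 ?sqr_ge0// ltW.
Qed.

End DualProblem.

(** * Bisection *)

(** The interval is halved around the zero r unless a midpoint is itself a zero,
in which case the interval stays constant; hence the disjunction. *)
Lemma dichotomy_bracket (R : realType) (dphi : R -> R) (a b r : R) (m : nat) :
  {in `[a, b] &, {homo dphi : p q / p <= q}} -> a <= r -> r <= b -> dphi r = 0 ->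
  let ab := iter m (dichotomy_step dphi) (a, b) in
  [/\ a <= ab.1, ab.1 <= r, r <= ab.2, ab.2 <= b &
      dphi (midpoint ab) = 0 \/ ab.2 - ab.1 = (b - a) / 2 ^+ m].
Proof.
move=> dphi_homo ar rb dr; elim: m => [|m] /=.
  by split => //; right; rewrite divr1.
set ab := iter m _ _; case: ab => u v /= [au ur rv vb disj].
rewrite /dichotomy_step /=; set p := midpoint (u, v).
have pE : p = (u + v) / 2 by [].
have up : u <= p by lra.
have pv : p <= v by lra.
have pin : p \in `[a, b] by rewrite in_itv /=; apply/andP; split; lra.
have rin : r \in `[a, b] by rewrite in_itv /= ar rb.
have half : dphi p != 0 -> (v - u) / 2 = (b - a) / 2 ^+ m.+1.
  move=> dp; case: disj => [/eqP|->]; first by rewrite (negPf dp).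
  by rewrite exprSr invfM mulrA.
case: (ltgtP (dphi p) 0) => dp /=.
- have rp : p <= r.
    by rewrite leNgt; apply/negP => /ltW /(dphi_homo _ _ rin pin); rewrite dr leNgt dp.
  split; rewrite ?(le_trans au)//; right; rewrite -half ?lt_eqF// pE; lra.
- have rp : r <= p.
    by rewrite leNgt; apply/negP => /ltW /(dphi_homo _ _ pin rin); rewrite dr leNgt dp.
  split; rewrite ?(le_trans pv)//; right; rewrite -half ?gt_eqF// pE; lra.
- by split => //; left.
Qed.

(** Either pN is within pmax / 2^N of p, and the Lipschitz bound applies, or the
dual derivative vanishes at pN and convexity makes pN another minimiser. *)
Lemma dual_gap_dichotomy_price (R : realType) (n : nat) (C mu : R)
    (f : 'I_n -> R -> R) (p M : R) (N : nat) :
  (0 < n)%N -> 0 < C -> 0 < mu ->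
  (forall k, nondecreasing_nneg (f k)) ->
  (forall k, strongly_convex_nneg mu (f k)) ->
  dual_solution f C p ->
  (forall q r, q \in `[0, pmax f C] -> r \in `[0, pmax f C] ->
     `|dual f C q - dual f C r| <= M * `|q - r|) ->
  (0 < N)%N ->
  0 <= dichotomy_price f C N <= pmax f C /\
  dual f C (dichotomy_price f C N) - dual f C p <= M * pmax f C / 2 ^+ N.
Proof.
move=> n0 C0 mu0 fi fc psol lip N0.
have p0 := psol.1; have dp := dual_solution_deriv mu0 fi fc C0 psol.
have pP := dual_solution_lt_pmax mu0 fi fc n0 C0 psol.
have P0 := le_lt_trans p0 pP.
have M0 : 0 <= M.
  have h0 : 0 \in `[0, pmax f C] by rewrite in_itv /= lexx ltW.
  have hP : pmax f C \in `[0, pmax f C] by rewrite in_itv /= lexx ltW.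
  have := le_trans (normr_ge0 _) (lip _ _ hP h0).
  by rewrite subr0 pmulr_lge0// normr_gt0 gt_eqF.
have homo : {in `[0, pmax f C] &, {homo dual_deriv f C : q r / q <= r}}.
  by move=> q r; rewrite !in_itv /= => /andP[q0 _] _; exact: (dual_deriv_homo C mu0 fi fc q0).
have := dichotomy_bracket N.-1 homo p0 (ltW pP) dp.
rewrite /dichotomy_price; case: (iter _ _ _) => u v; cbv zeta => /= -[u0 up pv vP disj].
set q := midpoint _ in disj *; have qE : q = (u + v) / 2 by [].
have q0 : 0 <= q by lra.
have qP : q <= pmax f C by lra.
split; first by rewrite q0.
case: disj => [dq|uv].
  have := dual_growth C mu0 fi fc p0 q0; rewrite dq mul0r addr0.
  have : 0 <= mu / 2 * enorm (response f p - response f q) ^+ 2.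
    by rewrite mulr_ge0 ?sqr_ge0// divr_ge0// ltW.
  have : 0 <= M * pmax f C / 2 ^+ N.
    by rewrite divr_ge0 ?exprn_ge0// mulr_ge0// ltW.
  lra.
have qin : q \in `[0, pmax f C] by rewrite in_itv /= q0.
have pin : p \in `[0, pmax f C] by rewrite in_itv /= p0 ltW.
apply: le_trans (ler_norm _) _; apply: le_trans (lip _ _ qin pin) _.
rewrite -mulrA ler_wpM2l// -(prednK N0) exprSr invfM mulrA.
rewrite -[X in X / 2 ^+ _]subr0 -uv ler_norml; apply/andP; split; lra.
Qed.

(** * Convergence rates *)

Lemma pow2_half_sqrt (R : realType) (N : nat) (X : R) :
  1 / 2 `^ (N%:R / 2) * Num.sqrt X = Num.sqrt (X / 2 ^+ N).
Proof.
rewrite powRrM powR_mulrn// powR12_sqrt ?exprn_ge0//.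
by rewrite mulrC [in RHS]mulrC sqrtrM ?invr_ge0 ?exprn_ge0// sqrtrV ?exprn_ge0// mul1r mulrC.
Qed.

Lemma log2_le (R : realType) (X : R) (N : nat) :
  0 < X -> log2 X <= N%:R -> X <= 2 ^+ N.
Proof.
move=> X0; have ln2 : 0 < ln 2 :> R by rewrite ln_gt0// ltr1n.
rewrite /log2 ler_pdivrMr// -ln_powR powR_mulrn// ler_ln//.
by rewrite posrE exprn_gt0.
Qed.

Theorem mainTheorem1 (R : realType) (n : nat) (C mu : R) (f : 'I_n -> R -> R)
    (n_ge1 : (1 <= n)%N) (C_gt0 : 0 < C) (mu_gt0 : 0 < mu)
    (f_incr : forall k, nondecreasing_nneg (f k))
    (f_cvx : forall k, strongly_convex_nneg mu (f k))
    (pstar : R) (pstar_sol : dual_solution f C pstar)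
    (Lphi : R) (Lphi_def : Lphi = n%:R / mu)
    (Mphi : R)
    (Mphi_lip : Mphi.-lipschitz_(`[0, pmax f C]%classic) (dual f C : R^o -> R^o))
    (D : set 'cV[R]_n) (Mf : R)
    (D_orthant : D `<=` @orthant R n)
    (D_response : forall p, p \in `[0, pmax f C] -> D (response f p))
    (D_projection : forall p, p \in `[0, pmax f C] ->
       euclidean_projection (feasible C) (response f p) `<=` D)
    (Mf_lip : forall x y, D x -> D y ->
       `|cost f x - cost f y| <= Mf * enorm (x - y)) :
  let P := pmax f C in
  let pN := dichotomy_price f C in
  let xstar := response f pstar in
  [/\ (* xstar is the solution of the primal problem *)
      primal_solution f C = [set xstar],
      forall N : nat, (1 <= N)%N ->
        cost f (response f (pN N)) - cost f xstar
          <= 1 / 2 `^ (N%:R / 2) * Num.sqrt (2 * Lphi * Mphi * P ^+ 3)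
        /\
        enorm (response f (pN N) - xstar)
          <= 1 / 2 `^ (N%:R / 4)
               * Num.sqrt (Num.sqrt (8 * Lphi * Mphi * P ^+ 3 / mu ^+ 2)
                   + Num.sqrt (8 * Lphi * Mphi * Mf ^+ 2 * P
                                 / (n%:R * mu ^+ 2)))
             + 1 / 2 `^ (N%:R / 2) * Num.sqrt (2 * Lphi * Mphi * P / n%:R)
    & forall (eps : R) (N : nat), 0 < eps -> (1 <= N)%N ->
        log2 (2 * Lphi * Mphi * P ^+ 3 / eps ^+ 2) <= N%:R ->
        cost f (response f (pN N)) - cost f xstar <= eps].
Proof.
have mu0 := mu_gt0; have p0 := pstar_sol.1.
have dstar := dual_solution_deriv mu0 f_incr f_cvx C_gt0 pstar_sol.
have lip q r : q \in `[0, pmax f C] -> r \in `[0, pmax f C] ->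
    `|dual f C q - dual f C r| <= Mphi * `|q - r|.
  by move=> qin rin; exact: (Mphi_lip (q, r) (conj qin rin)).
have main N : (1 <= N)%N ->
    let q := dichotomy_price f C N in
    [/\ 0 <= q, q <= pmax f C & mu / 2 * enorm (response f q - response f pstar) ^+ 2
      <= Mphi * pmax f C / 2 ^+ N].
  move=> N0; have [/andP[q0 qP] gap] := dual_gap_dichotomy_price
    n_ge1 C_gt0 mu0 f_incr f_cvx pstar_sol lip N0.
  split => //; apply: le_trans gap.
  by have := dual_growth C mu0 f_incr f_cvx q0 p0; rewrite dstar mul0r addr0; lra.
move=> P pN xstar.
have n0 : 0 < n%:R :> R by rewrite ltr0n.
have argument N : (1 <= N)%N ->
    enorm (response f (pN N) - xstar) ^+ 2 <= 2 * Lphi * Mphi * P / n%:R / 2 ^+ N.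
  move=> /main[_ _]; rewrite -/(pN N) -/xstar -/P Lphi_def => h.
  have -> : 2 * (n%:R / mu) * Mphi * P / n%:R / 2 ^+ N
      = 2 / mu * (Mphi * P / 2 ^+ N) :> R.
    by field; rewrite expf_neq0// !gt_eqF.
  have := ler_wpM2l (divr_ge0 (ler0n _ 2) (ltW mu0)) h.
  by rewrite mulrA (_ : 2 / mu * (mu / 2) = 1) ?mul1r//; field; rewrite gt_eqF.
have value N : (1 <= N)%N ->
    cost f (response f (pN N)) - cost f xstar
      <= Num.sqrt (2 * Lphi * Mphi * P ^+ 3 / 2 ^+ N).
  move=> N1; have [q0 qP _] := main _ N1; have := argument _ N1.
  rewrite -/(pN N) in q0 qP *.
  set q := pN N in q0 qP *; set e := enorm _ => he.
  have := dual_deriv_sqr C f q pstar; rewrite dstar subr0 -/e => hd.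
  have := dual_growth C mu0 f_incr f_cvx q0 p0.
  rewrite dstar mul0r addr0 !dualE dstar mulr0 sub0r -/xstar -/e => hc.
  have hc' : cost f (response f q) - cost f xstar <= q * dual_deriv f C q.
    have : 0 <= mu / 2 * e ^+ 2 by rewrite mulr_ge0 ?sqr_ge0// divr_ge0// ltW.
    lra.
  apply: le_trans hc' _; apply: le_trans (ler_norm _) _.
  rewrite -sqrtr_sqr ler_wsqrtr// exprMn.
  have qP2 : q ^+ 2 <= P ^+ 2 by rewrite ler_sqr ?nnegrE// (le_trans q0).
  have hd' := le_trans hd (ler_wpM2l (ltW n0) he).
  apply: le_trans (ler_pM (sqr_ge0 _) (sqr_ge0 _) qP2 hd') _.
  rewrite le_eqVlt; apply/orP; left; apply/eqP.
  by field; rewrite expf_neq0// gt_eqF.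
split; first exact: (primal_solution_response mu0 f_incr f_cvx C_gt0 pstar_sol).
- move=> N N1; split; first by rewrite pow2_half_sqrt; exact: value.
  rewrite [X in _ <= _ + X]pow2_half_sqrt.
  apply: le_trans (_ : Num.sqrt (2 * Lphi * Mphi * P / n%:R / 2 ^+ N) <= _).
    rewrite -(ger0_norm (enorm_ge0 _)) -sqrtr_sqr; exact/ler_wsqrtr/argument.
  by rewrite lerDr mulr_ge0 ?sqrtr_ge0// mul1r invr_ge0 powR_ge0.
- move=> eps N eps0 N1 hlog; apply: le_trans (value _ N1) _.
  rewrite -(ger0_norm (ltW eps0)) -sqrtr_sqr; apply: ler_wsqrtr.
  rewrite ler_pdivrMr ?exprn_gt0//.
  set X := 2 * Lphi * Mphi * P ^+ 3 in hlog *.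
  have [X0|X0] := leP X 0.
    by apply: le_trans X0 _; rewrite mulr_ge0 ?sqr_ge0// exprn_ge0.
  have e2 : 0 < eps ^+ 2 by rewrite exprn_gt0.
  by rewrite mulrC -ler_pdivrMr//; apply: log2_le => //; rewrite divr_gt0.
Qed.
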